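(* Let $\mathcal{B}$ be a bicategory and let $\mathfrak{W}$ be a class of co-ff (co-fully-faithful) arrows in $\mathcal{B}$ satisfying conditions [WB1]--[WB5]. Then each 2-cell in $\mathcal{B}(\mathfrak{W}^{-1})$ has precisely one representative with a given left-hand 2-cell. That is, for any two spans $(u_1,f_1),(u_2,f_2)\colon A\to B$ in $\mathcal{B}(\mathfrak{W}^{-1})$ with apexes $C_1,C_2$, any arrows $t_1\colon D\to C_1$, $t_2\colon D\to C_2$ and any invertible 2-cell $\gamma\colon u_1t_1\Rightarrow u_2t_2$ with $u_1t_1\in\mathfrak{W}$, every 2-cell $(u_1,f_1)\Rightarrow(u_2,f_2)$ in $\mathcal{B}(\mathfrak{W}^{-1})$ is represented by $(\gamma,\delta;t_1,t_2)$ for exactly one 2-cell $\delta\colon f_1t_1\Rightarrow f_2t_2$ of $\mathcal{B}$.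
   Context: Associativity and unit constraints are suppressed; $gf$ is $f$ followed by $g$; $\alpha f$, $g\alpha$ are whiskerings; $(\beta)(\alpha)$ is vertical composition ($\alpha$ first). An arrow $w$ is co-ff if for any 2-cell $\alpha\colon fw\Rightarrow gw$ there is a unique 2-cell $\alpha'\colon f\Rightarrow g$ with $\alpha'w=\alpha$. **Conditions on $\mathfrak{W}$.** [WB1] All identities are in $\mathfrak{W}$. [WB2] For composable $v\colon B\to C$, $w\colon C\to D$ in $\mathfrak{W}$ there is an arrow $u\colon A\to B$ with $wvu\in\mathfrak{W}$. [WB3] For $w\colon A\to B$ in $\mathfrak{W}$ and $f\colon C\to B$ there are $h\colon D\to A$, $v\colon D\to C$ with $v\in\mathfrak{W}$ and an invertible 2-cell $\alpha\colon wh\Rightarrow fv$. [WB4] For any 2-cell $\alpha\colon wf\Rightarrow wg$ with $w\in\mathfrak{W}$ there are $u\in\mathfrak{W}$ and a 2-cell $\beta\colon fu\Rightarrow gu$ with $\alpha u=w\beta$; and if $(u_1,\beta_1)$, $(u_2,\beta_2)$ are two such pairs, there are arrows $s,t$ with $u_1s,u_2t\in\mathfrak{W}$ and an invertible 2-cell $\varepsilon\colon u_1s\Rightarrow u_2t$ with $(g\varepsilon)(\beta_1s)=(\beta_2t)(f\varepsilon)$. [WB5] If $w\in\mathfrak{W}$ and there is an invertible 2-cell $v\Rightarrow w$, then $v\in\mathfrak{W}$. **2-cells of the bicategory of fractions $\mathcal{B}(\mathfrak{W}^{-1})$.** Objects are those of $\mathcal{B}$. An arrow $A\to B$ is a span $(u,f)$: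 $A\xleftarrow{u}C\xrightarrow{f}B$ with $u\in\mathfrak{W}$. A 2-cell diagram from $(u_1,f_1)$ (apex $C_1$) to $(u_2,f_2)$ (apex $C_2$) is a tuple $(\alpha,\beta;s_1,s_2)$ with $s_i\colon D\to C_i$, an invertible 2-cell $\alpha\colon u_1s_1\Rightarrow u_2s_2$ and a 2-cell $\beta\colon f_1s_1\Rightarrow f_2s_2$, such that $u_1s_1\in\mathfrak{W}$; $\alpha$ (with $s_1,s_2$) is the left-hand 2-cell and $\beta$ the right-hand 2-cell. It is equivalent to $(\alpha',\beta';s_1',s_2')$ (with $s_i'\colon D'\to C_i$) iff there are $p\colon E\to D$, $q\colon E\to D'$ and invertible $\varepsilon_i\colon s_ip\Rightarrow s_i'q$ ($i=1,2$) with $u_1s_1p\in\mathfrak{W}$, $(u_2\varepsilon_2)(\alpha p)=(\alpha'q)(u_1\varepsilon_1)$ and $(f_2\varepsilon_2)(\beta p)=(\beta'q)(f_1\varepsilon_1)$. 2-cells are equivalence classes of 2-cell diagrams; members of a class are its representatives. *)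

(* Defs.v *)
Set Implicit Arguments.
Unset Strict Implicit.
Unset Printing Implicit Defensive.

(* Bicategories in the sense of Benabou; composites are written in functional
   order (g ∘ f is f followed by g), and equality of 2-cells is Leibniz
   equality.  The inverses of the constraints are part of the data, so that
   pastings can be reassociated by a function. *)
Record bicat_data := BicatData {
  Ob :> Type;
  Hom : Ob -> Ob -> Type;
  Cell : forall {A B : Ob}, Hom A B -> Hom A B -> Type;
  id1 : forall A : Ob, Hom A A;
  comp1 : forall {A B C : Ob}, Hom B C -> Hom A B -> Hom A C;
  id2 : forall {A B : Ob} (f : Hom A B), Cell f f;
  vcomp : forall {A B : Ob} {f g h : Hom A B}, Cell g h -> Cell f g -> Cell f h;
  hcomp : forall {A B C : Ob} {g g' : Hom B C} {f f' : Hom A B},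
    Cell g g' -> Cell f f' -> Cell (comp1 g f) (comp1 g' f');
  assoc : forall {A B C D : Ob} (h : Hom C D) (g : Hom B C) (f : Hom A B),
    Cell (comp1 (comp1 h g) f) (comp1 h (comp1 g f));
  assoc_inv : forall {A B C D : Ob} (h : Hom C D) (g : Hom B C) (f : Hom A B),
    Cell (comp1 h (comp1 g f)) (comp1 (comp1 h g) f);
  lunit : forall {A B : Ob} (f : Hom A B), Cell (comp1 (id1 B) f) f;
  lunit_inv : forall {A B : Ob} (f : Hom A B), Cell f (comp1 (id1 B) f);
  runit : forall {A B : Ob} (f : Hom A B), Cell (comp1 f (id1 A)) f;
  runit_inv : forall {A B : Ob} (f : Hom A B), Cell f (comp1 f (id1 A))
}.

Arguments id1 {b} A.

Declare Scope bicat_scope.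
Delimit Scope bicat_scope with bicat.
Open Scope bicat_scope.

Notation "f ⇒ g" := (Cell f g) (at level 70, no associativity) : bicat_scope.
Notation "g ∘ f" := (comp1 g f) (at level 40, left associativity) : bicat_scope.
Notation "β • α" := (vcomp β α) (at level 60, right associativity) : bicat_scope.
Notation "β ⋆ α" := (hcomp β α) (at level 50, left associativity) : bicat_scope.
Notation "g ◁ α" := (hcomp (id2 g) α) (at level 50, left associativity) : bicat_scope.
Notation "α ▷ f" := (hcomp α (id2 f)) (at level 50, left associativity) : bicat_scope.

Record bicategory := Bicategory {
  bicat_data_of :> bicat_data;
  vcomp_id_l : forall (A B : bicat_data_of) (f g : Hom A B) (α : f ⇒ g),
    id2 g • α = α;
  vcomp_id_r : forall (A B : bicat_data_of) (f g : Hom A B) (α : f ⇒ g),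
    α • id2 f = α;
  vcomp_assoc : forall (A B : bicat_data_of) (f g h k : Hom A B)
    (γ : h ⇒ k) (β : g ⇒ h) (α : f ⇒ g), (γ • β) • α = γ • (β • α);
  hcomp_id : forall (A B C : bicat_data_of) (g : Hom B C) (f : Hom A B),
    id2 g ⋆ id2 f = id2 (g ∘ f);
  interchange : forall (A B C : bicat_data_of)
    (g g' g'' : Hom B C) (f f' f'' : Hom A B)
    (β' : g' ⇒ g'') (β : g ⇒ g') (α' : f' ⇒ f'') (α : f ⇒ f'),
    (β' • β) ⋆ (α' • α) = (β' ⋆ α') • (β ⋆ α);
  assoc_nat : forall (A B C D : bicat_data_of)
    (h h' : Hom C D) (g g' : Hom B C) (f f' : Hom A B)
    (γ : h ⇒ h') (β : g ⇒ g') (α : f ⇒ f'),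
    assoc h' g' f' • (γ ⋆ β ⋆ α) = (γ ⋆ (β ⋆ α)) • assoc h g f;
  assoc_K : forall (A B C D : bicat_data_of)
    (h : Hom C D) (g : Hom B C) (f : Hom A B),
    assoc_inv h g f • assoc h g f = id2 (h ∘ g ∘ f);
  assoc_inv_K : forall (A B C D : bicat_data_of)
    (h : Hom C D) (g : Hom B C) (f : Hom A B),
    assoc h g f • assoc_inv h g f = id2 (h ∘ (g ∘ f));
  lunit_nat : forall (A B : bicat_data_of) (f g : Hom A B) (α : f ⇒ g),
    lunit g • (id1 B ◁ α) = α • lunit f;
  lunit_K : forall (A B : bicat_data_of) (f : Hom A B),
    lunit_inv f • lunit f = id2 (id1 B ∘ f);
  lunit_inv_K : forall (A B : bicat_data_of) (f : Hom A B),
    lunit f • lunit_inv f = id2 f;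
  runit_nat : forall (A B : bicat_data_of) (f g : Hom A B) (α : f ⇒ g),
    runit g • (α ▷ id1 A) = α • runit f;
  runit_K : forall (A B : bicat_data_of) (f : Hom A B),
    runit_inv f • runit f = id2 (f ∘ id1 A);
  runit_inv_K : forall (A B : bicat_data_of) (f : Hom A B),
    runit f • runit_inv f = id2 f;
  triangle : forall (A B C : bicat_data_of) (g : Hom B C) (f : Hom A B),
    (g ◁ lunit f) • assoc g (id1 B) f = runit g ▷ f;
  pentagon : forall (A B C D E : bicat_data_of)
    (k : Hom D E) (h : Hom C D) (g : Hom B C) (f : Hom A B),
    assoc k h (g ∘ f) • assoc (k ∘ h) g f =
      (k ◁ assoc h g f) • assoc k (h ∘ g) f • (assoc k h g ▷ f)
}.

Definition invertible (B : bicategory) (X Y : B) (f g : Hom X Y)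
    (α : f ⇒ g) : Prop :=
  exists β : g ⇒ f, β • α = id2 f /\ α • β = id2 g.

(* The whiskering of α : f u ⇒ f' u' by s, between the right-bracketed
   composites.  With associativity suppressed this is just α s; all whiskerings
   of composites below are reassociated in this way. *)
Definition whisker (B : bicategory) (X Y Y' Z T : B)
    (f : Hom Y Z) (u : Hom X Y) (f' : Hom Y' Z) (u' : Hom X Y')
    (α : f ∘ u ⇒ f' ∘ u') (s : Hom T X) : f ∘ (u ∘ s) ⇒ f' ∘ (u' ∘ s) :=
  assoc f' u' s • (α ▷ s) • assoc_inv f u s.

Definition co_ff (B : bicategory) (X Y : B) (w : Hom X Y) : Prop :=
  forall (Z : B) (f g : Hom Y Z) (α : f ∘ w ⇒ g ∘ w),
    exists! α' : f ⇒ g, α' ▷ w = α.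

Definition arrow_class (B : bicategory) := forall X Y : B, Hom X Y -> Prop.

Section Conditions.
Variables (B : bicategory) (W : arrow_class B).

Definition WB1 : Prop := forall X : B, W (id1 X).

Definition WB2 : Prop :=
  forall (Y Z T : B) (v : Hom Y Z) (w : Hom Z T), W v -> W w ->
    exists (X : B) (u : Hom X Y), W (w ∘ (v ∘ u)).

Definition WB3 : Prop :=
  forall (X Y Z : B) (w : Hom X Y) (f : Hom Z Y), W w ->
    exists (T : B) (h : Hom T X) (v : Hom T Z) (α : w ∘ h ⇒ f ∘ v),
      W v /\ invertible α.

Definition lift_along (X Y Z : B) (w : Hom Y Z) (f g : Hom X Y)
    (α : w ∘ f ⇒ w ∘ g) (T : B) (u : Hom T X) (β : f ∘ u ⇒ g ∘ u) : Prop :=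
  W u /\ whisker α u = w ◁ β.

Definition WB4 : Prop :=
  forall (X Y Z : B) (w : Hom Y Z) (f g : Hom X Y) (α : w ∘ f ⇒ w ∘ g),
    W w ->
    (exists (T : B) (u : Hom T X) (β : f ∘ u ⇒ g ∘ u), lift_along α β) /\
    (forall (T1 T2 : B) (u1 : Hom T1 X) (u2 : Hom T2 X)
        (β1 : f ∘ u1 ⇒ g ∘ u1) (β2 : f ∘ u2 ⇒ g ∘ u2),
      lift_along α β1 -> lift_along α β2 ->
      exists (S : B) (s : Hom S T1) (t : Hom S T2) (ε : u1 ∘ s ⇒ u2 ∘ t),
        W (u1 ∘ s) /\ W (u2 ∘ t) /\ invertible ε /\
        (g ◁ ε) • whisker β1 s = whisker β2 t • (f ◁ ε)).

Definition WB5 : Prop :=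
  forall (X Y : B) (v w : Hom X Y) (α : v ⇒ w), W w -> invertible α -> W v.

End Conditions.

Section Fractions.
Variables (B : bicategory) (W : arrow_class B).

Record span (X Y : B) := Span {
  apex : B;
  lleg : Hom apex X;
  rleg : Hom apex Y;
  lleg_W : W lleg
}.

Record diagram (X Y : B) (σ1 σ2 : span X Y) := Diagram {
  dapex : B;
  dleg1 : Hom dapex (apex σ1);
  dleg2 : Hom dapex (apex σ2);
  left_cell : lleg σ1 ∘ dleg1 ⇒ lleg σ2 ∘ dleg2;
  right_cell : rleg σ1 ∘ dleg1 ⇒ rleg σ2 ∘ dleg2;
  left_cell_inv : invertible left_cell;
  dleg1_W : W (lleg σ1 ∘ dleg1)
}.

Definition diagram_equiv (X Y : B) (σ1 σ2 : span X Y)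
    (d d' : diagram σ1 σ2) : Prop :=
  exists (E : B) (p : Hom E (dapex d)) (q : Hom E (dapex d'))
    (ε1 : dleg1 d ∘ p ⇒ dleg1 d' ∘ q) (ε2 : dleg2 d ∘ p ⇒ dleg2 d' ∘ q),
    invertible ε1 /\ invertible ε2 /\
    W (lleg σ1 ∘ (dleg1 d ∘ p)) /\
    (lleg σ2 ◁ ε2) • whisker (left_cell d) p =
      whisker (left_cell d') q • (lleg σ1 ◁ ε1) /\
    (rleg σ2 ◁ ε2) • whisker (right_cell d) p =
      whisker (right_cell d') q • (rleg σ1 ◁ ε1).

(* A 2-cell of the bicategory of fractions: an equivalence class of diagrams,
   given as the predicate of being one of its representatives. *)
Record frac_cell (X Y : B) (σ1 σ2 : span X Y) := FracCell {
  representative : diagram σ1 σ2 -> Prop;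
  representative_class : exists d0 : diagram σ1 σ2,
    forall d : diagram σ1 σ2, representative d <-> diagram_equiv d0 d
}.

End Fractions.

(* Main.v *)
Require Import Defs.
From Corelib Require Import ssreflect.

(** The idea is that under the hypotheses every arrow w of W is fully faithful
    as well as co-fully faithful: a lift of w f ⇒ w g along some u in W, as
    given by WB4, descends along u because u is co-ff.  Hence the 2-cells
    ε1, ε2 comparing two left-hand 2-cells are obtained by lifting along u1, u2,
    and the right-hand 2-cell δ by descending along an arrow of W given by WB3.
    For uniqueness, two comparisons of the same diagrams become isomorphic after
    precomposition, so that δ q = δ' q for some q with u1 t1 q in W; such a q
    is co-faithful, since by WB3 and full faithfulness of u1 t1 some q h is in W. *)

Section Calculus.
Set Implicit Arguments.
Unset Strict Implicit.
Variable B : bicategory.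

(** * Invertible 2-cells and isomorphic arrows *)

Lemma invertible_id2 (X Y : B) (f : Hom X Y) : invertible (id2 f).
Proof. by exists (id2 f); rewrite vcomp_id_l. Qed.

Lemma invertible_vcomp (X Y : B) (f g h : Hom X Y) (β : g ⇒ h) (α : f ⇒ g) :
  invertible β -> invertible α -> invertible (β • α).
Proof.
move=> [β' [bK Kb]] [α' [aK Ka]]; exists (α' • β').
by rewrite !vcomp_assoc -(vcomp_assoc β') -(vcomp_assoc α) bK Ka !vcomp_id_l aK Kb.
Qed.

Lemma invertible_hcomp (X Y Z : B) (g g' : Hom Y Z) (f f' : Hom X Y)
    (β : g ⇒ g') (α : f ⇒ f') :
  invertible β -> invertible α -> invertible (β ⋆ α).
Proof.
move=> [β' [bK Kb]] [α' [aK Ka]]; exists (β' ⋆ α').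
by rewrite -!interchange bK Kb aK Ka !hcomp_id.
Qed.

Lemma invertible_assoc (X Y Z T : B) (h : Hom Z T) (g : Hom Y Z) (f : Hom X Y) :
  invertible (assoc h g f).
Proof. by exists (assoc_inv h g f); rewrite assoc_K assoc_inv_K. Qed.

Lemma invertible_assoc_inv (X Y Z T : B)
    (h : Hom Z T) (g : Hom Y Z) (f : Hom X Y) : invertible (assoc_inv h g f).
Proof. by exists (assoc h g f); rewrite assoc_K assoc_inv_K. Qed.

Lemma invertible_mono (X Y : B) (f g h : Hom X Y) (β : g ⇒ h) (α α' : f ⇒ g) :
  invertible β -> β • α = β • α' -> α = α'.
Proof.
move=> [β' [bK _]] /(f_equal (vcomp β')).
by rewrite -!vcomp_assoc bK !vcomp_id_l.
Qed.

Lemma invertible_epi (X Y : B) (f g h : Hom X Y) (β β' : g ⇒ h) (α : f ⇒ g) :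
  invertible α -> β • α = β' • α -> β = β'.
Proof.
move=> [α' [_ Ka]] /(f_equal (fun x => x • α')).
by rewrite !vcomp_assoc Ka !vcomp_id_r.
Qed.

Lemma lwhisker_vcomp (X Y Z : B) (k : Hom Y Z) (f g h : Hom X Y)
    (β : g ⇒ h) (α : f ⇒ g) : k ◁ (β • α) = (k ◁ β) • (k ◁ α).
Proof. by rewrite -interchange vcomp_id_l. Qed.

Lemma rwhisker_vcomp (X Y Z : B) (k : Hom X Y) (f g h : Hom Y Z)
    (β : g ⇒ h) (α : f ⇒ g) : (β • α) ▷ k = (β ▷ k) • (α ▷ k).
Proof. by rewrite -interchange vcomp_id_l. Qed.

Lemma whisker_exchange (X Y Z : B) (g g' : Hom Y Z) (f f' : Hom X Y)
    (β : g ⇒ g') (α : f ⇒ f') : (g' ◁ α) • (β ▷ f) = (β ▷ f') • (g ◁ α).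
Proof. by rewrite -!interchange !vcomp_id_l !vcomp_id_r. Qed.

Definition iso (X Y : B) (f g : Hom X Y) := exists α : f ⇒ g, invertible α.

Lemma iso_sym (X Y : B) (f g : Hom X Y) : iso f g -> iso g f.
Proof. by move=> [α [β [aK Ka]]]; exists β, α. Qed.

Lemma iso_trans (X Y : B) (f g h : Hom X Y) : iso f g -> iso g h -> iso f h.
Proof.
by move=> [α Hα] [β Hβ]; exists (β • α); exact: invertible_vcomp Hβ Hα.
Qed.

Lemma iso_comp1l (X Y Z : B) (k : Hom Y Z) (f g : Hom X Y) :
  iso f g -> iso (k ∘ f) (k ∘ g).
Proof.
move=> [α Hα]; exists (k ◁ α).
exact: invertible_hcomp (invertible_id2 _) Hα.
Qed.

Lemma iso_comp1r (X Y Z : B) (k : Hom X Y) (f g : Hom Y Z) :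
  iso f g -> iso (f ∘ k) (g ∘ k).
Proof.
move=> [α Hα]; exists (α ▷ k).
exact: invertible_hcomp Hα (invertible_id2 _).
Qed.

Lemma iso_assoc (X Y Z T : B) (h : Hom Z T) (g : Hom Y Z) (f : Hom X Y) :
  iso (h ∘ g ∘ f) (h ∘ (g ∘ f)).
Proof. by exists (assoc h g f); exact: invertible_assoc. Qed.

(** * Calculus of reassociated whiskerings *)

Lemma whisker_assoc (X Y Y' Z T : B)
    (f : Hom Y Z) (u : Hom X Y) (f' : Hom Y' Z) (u' : Hom X Y')
    (α : f ∘ u ⇒ f' ∘ u') (s : Hom T X) :
  whisker α s • assoc f u s = assoc f' u' s • (α ▷ s).
Proof. by rewrite /whisker !vcomp_assoc assoc_K vcomp_id_r. Qed.

Lemma invertible_whisker (X Y Y' Z T : B)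
    (f : Hom Y Z) (u : Hom X Y) (f' : Hom Y' Z) (u' : Hom X Y')
    (α : f ∘ u ⇒ f' ∘ u') (s : Hom T X) :
  invertible α -> invertible (whisker α s).
Proof.
move=> Hα; apply: invertible_vcomp; first exact: invertible_assoc.
apply: invertible_vcomp; last exact: invertible_assoc_inv.
exact: invertible_hcomp Hα (invertible_id2 _).
Qed.

Lemma whisker_inj (X Y Y' Z T : B)
    (f : Hom Y Z) (u : Hom X Y) (f' : Hom Y' Z) (u' : Hom X Y')
    (α α' : f ∘ u ⇒ f' ∘ u') (s : Hom T X) :
  whisker α s = whisker α' s -> α ▷ s = α' ▷ s.
Proof.
move=> /(f_equal (fun x => x • assoc f u s)); rewrite !whisker_assoc.
exact: invertible_mono (invertible_assoc _ _ _).
Qed.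

Lemma whisker_vcomp (X Y Y' Y'' Z T : B)
    (f : Hom Y Z) (u : Hom X Y) (f' : Hom Y' Z) (u' : Hom X Y')
    (f'' : Hom Y'' Z) (u'' : Hom X Y'')
    (β : f' ∘ u' ⇒ f'' ∘ u'') (α : f ∘ u ⇒ f' ∘ u') (s : Hom T X) :
  whisker (β • α) s = whisker β s • whisker α s.
Proof.
apply: (invertible_epi (invertible_assoc f u s)).
by rewrite whisker_assoc vcomp_assoc whisker_assoc -vcomp_assoc whisker_assoc
           vcomp_assoc rwhisker_vcomp.
Qed.

Lemma whisker_nat (X Y Y' Z T : B)
    (f : Hom Y Z) (u : Hom X Y) (f' : Hom Y' Z) (u' : Hom X Y')
    (α : f ∘ u ⇒ f' ∘ u') (s s' : Hom T X) (ε : s ⇒ s') :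
  (f' ◁ (u' ◁ ε)) • whisker α s = whisker α s' • (f ◁ (u ◁ ε)).
Proof.
apply: (invertible_epi (invertible_assoc f u s)).
(* Generalizing keeps [vcomp_assoc] from unfolding the whiskerings. *)
move: (whisker_assoc α s) (whisker_assoc α s').
move: (whisker α s) (whisker α s') => x y Hx Hy.
rewrite !vcomp_assoc Hx -assoc_nat -!vcomp_assoc Hy.
by rewrite -assoc_nat !hcomp_id !vcomp_assoc whisker_exchange.
Qed.

Lemma whisker_lwhisker (X Y Z T : B) (f : Hom Y Z) (u u' : Hom X Y)
    (α : u ⇒ u') (s : Hom T X) : whisker (f ◁ α) s = f ◁ (α ▷ s).
Proof.
apply: (invertible_epi (invertible_assoc f u s)).
by rewrite whisker_assoc assoc_nat.
Qed.

Lemma whisker_rwhisker (X Y Z T : B) (f f' : Hom Y Z) (u : Hom X Y)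
    (α : f ⇒ f') (s : Hom T X) : whisker (α ▷ u) s = α ▷ (u ∘ s).
Proof.
apply: (invertible_epi (invertible_assoc f u s)).
by rewrite whisker_assoc assoc_nat hcomp_id.
Qed.

(** After precomposition with the invertible associators [He], this is the pentagon together with
    naturality of [assoc]. *)
Lemma whisker_comp (X Y Y' Z T S : B)
    (f : Hom Y Z) (u : Hom X Y) (f' : Hom Y' Z) (u' : Hom X Y')
    (α : f ∘ u ⇒ f' ∘ u') (s : Hom T X) (t : Hom S T) :
  (f' ◁ assoc u' s t) • whisker (whisker α s) t =
    whisker α (s ∘ t) • (f ◁ assoc u s t).
Proof.
have He : invertible (assoc f (u ∘ s) t • (assoc f u s ▷ t)).
  apply: invertible_vcomp; first exact: invertible_assoc.
  exact: invertible_hcomp (invertible_assoc _ _ _) (invertible_id2 _).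
apply: (invertible_epi He).
move: (whisker_assoc (whisker α s) t) (whisker_assoc α (s ∘ t)).
move: (whisker_assoc α s) => /(f_equal (fun x => x ▷ t)).
rewrite !rwhisker_vcomp; move: (whisker α s) => x.
move: (whisker x t) (whisker α (s ∘ t)) => y z Hx Hy Hz.
rewrite !vcomp_assoc -pentagon -(vcomp_assoc y) Hy vcomp_assoc Hx.
rewrite -(vcomp_assoc z) Hz vcomp_assoc.
by rewrite -hcomp_id -assoc_nat -!vcomp_assoc pentagon !vcomp_assoc.
Qed.

(* One half of the equivalence of diagrams is stable under precomposition; the
   new comparison cells are ε1 a and ε2 a. *)
Lemma comparison_whisker (A1 A2 Z D D' E T : B)
    (f1 : Hom A1 Z) (s1 : Hom D A1) (t1 : Hom D' A1)
    (f2 : Hom A2 Z) (s2 : Hom D A2) (t2 : Hom D' A2)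
    (β : f1 ∘ s1 ⇒ f2 ∘ s2) (δ : f1 ∘ t1 ⇒ f2 ∘ t2)
    (p : Hom E D) (q : Hom E D')
    (ε1 : s1 ∘ p ⇒ t1 ∘ q) (ε2 : s2 ∘ p ⇒ t2 ∘ q) (a : Hom T E) :
  (f2 ◁ ε2) • whisker β p = whisker δ q • (f1 ◁ ε1) ->
  (f2 ◁ whisker ε2 a) • whisker β (p ∘ a) =
    whisker δ (q ∘ a) • (f1 ◁ whisker ε1 a).
Proof.
(* Whisker the equation by [a]; [whisker_comp] then merges the iterated whiskerings into whiskerings
   by [p ∘ a] and [q ∘ a]. *)
move=> /(f_equal (fun x => whisker x a)).
rewrite (whisker_vcomp (f2 ◁ ε2)) (whisker_vcomp (whisker δ q)).
rewrite !whisker_lwhisker => H.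
have He : invertible (f1 ◁ assoc s1 p a).
  exact: invertible_hcomp (invertible_id2 _) (invertible_assoc _ _ _).
apply: (invertible_epi He).
move: (whisker_assoc ε1 a) (whisker_assoc ε2 a).
move: (whisker ε1 a) (whisker ε2 a) => e1 e2.
move=> /(f_equal (hcomp (id2 f1))) H1 /(f_equal (hcomp (id2 f2))) H2.
move: (whisker_comp β p a) (whisker_comp δ q a) H H1 H2; rewrite !lwhisker_vcomp.
move: (whisker (whisker β p) a) (whisker (whisker δ q) a) => b d.
move: (whisker β (p ∘ a)) (whisker δ (q ∘ a)) => b' d' Hb Hd H H1 H2.
rewrite !vcomp_assoc -Hb -vcomp_assoc H2 vcomp_assoc H.
by rewrite -vcomp_assoc Hd !vcomp_assoc H1.
Qed.

(* If (ε1, ε2) and (ε1', ε2') are comparisons between the same diagrams along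
   (p, q) and (p', q'), this expresses one through η : p ⇒ p' and θ : q ⇒ q'. *)
Lemma comparison_transport (A1 A2 Z D D' E : B)
    (f1 : Hom A1 Z) (s1 : Hom D A1) (t1 : Hom D' A1)
    (f2 : Hom A2 Z) (s2 : Hom D A2) (t2 : Hom D' A2)
    (β : f1 ∘ s1 ⇒ f2 ∘ s2) (δ : f1 ∘ t1 ⇒ f2 ∘ t2)
    (p p' : Hom E D) (q q' : Hom E D')
    (ε1 : s1 ∘ p ⇒ t1 ∘ q)
    (ε1' : s1 ∘ p' ⇒ t1 ∘ q') (ε2' : s2 ∘ p' ⇒ t2 ∘ q')
    (η : p ⇒ p') (θ : q ⇒ q') :
  (t1 ◁ θ) • ε1 = ε1' • (s1 ◁ η) ->
  (f2 ◁ ε2') • whisker β p' = whisker δ q' • (f1 ◁ ε1') ->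
  (f2 ◁ (t2 ◁ θ)) • whisker δ q • (f1 ◁ ε1) =
    (f2 ◁ (ε2' • (s2 ◁ η))) • whisker β p.
Proof.
move=> H1 H.
rewrite -vcomp_assoc (whisker_nat δ) vcomp_assoc -lwhisker_vcomp H1.
rewrite !lwhisker_vcomp -vcomp_assoc -H [RHS]vcomp_assoc (whisker_nat β).
by rewrite vcomp_assoc.
Qed.

Lemma co_ff_whisker (X Y Y' Z T : B)
    (f : Hom Y Z) (u : Hom X Y) (f' : Hom Y' Z) (u' : Hom X Y') (w : Hom T X)
    (κ : f ∘ (u ∘ w) ⇒ f' ∘ (u' ∘ w)) :
  co_ff w -> exists δ : f ∘ u ⇒ f' ∘ u', whisker δ w = κ.
Proof.
move=> Hw; have [δ [Hδ _]] := Hw _ _ _ (assoc_inv f' u' w • κ • assoc f u w).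
exists δ; apply: (invertible_epi (invertible_assoc f u w)).
by rewrite whisker_assoc Hδ -vcomp_assoc assoc_inv_K vcomp_id_l.
Qed.

Lemma co_ff_inj (X Y Z : B) (w : Hom X Y) (f g : Hom Y Z) (α β : f ⇒ g) :
  co_ff w -> α ▷ w = β ▷ w -> α = β.
Proof.
move=> Hw H; have [γ [_ Hγ]] := Hw _ _ _ (β ▷ w).
by rewrite -(Hγ α H) -(Hγ β).
Qed.

End Calculus.

Section CoFullyFaithfulClass.
Set Implicit Arguments.
Unset Strict Implicit.
Variables (B : bicategory) (W : arrow_class B).
Hypothesis Wcoff : forall (X Y : B) (w : Hom X Y), W w -> co_ff w.
Hypotheses (W1 : WB1 W) (W2 : WB2 W) (W3 : WB3 W) (W4 : WB4 W) (W5 : WB5 W).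

(** * Full faithfulness of the arrows of [W] *)

Lemma class_full (X Y Z : B) (w : Hom Y Z) (f g : Hom X Y)
    (α : w ∘ f ⇒ w ∘ g) : W w -> exists β : f ⇒ g, w ◁ β = α.
Proof.
move=> Ww; have [[T [u [β [Wu Hβ]]]] _] := W4 α Ww.
have [β0 [Hβ0 _]] := Wcoff Wu β.
exists β0; apply: (co_ff_inj (Wcoff Wu)); apply: whisker_inj.
by rewrite Hβ whisker_lwhisker Hβ0.
Qed.

(** Both [α] and [β] lift [w ◁ α] along the identity, so the second half of WB4 compares them by an
    invertible [ε]. By exchange [ε] cancels, leaving equality after whiskering by [id1 X ∘ s], which
    lies in [W] and hence is co-ff. *)
Lemma class_faithful (X Y Z : B) (w : Hom Y Z) (f g : Hom X Y) (α β : f ⇒ g) :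
  W w -> w ◁ α = w ◁ β -> α = β.
Proof.
move=> Ww H; have [_ uniq] := W4 (w ◁ α) Ww.
have lift (κ : f ⇒ g) : w ◁ α = w ◁ κ -> lift_along W (w ◁ α) (κ ▷ id1 X).
  by move=> ->; split; [exact: W1 | exact: whisker_lwhisker].
have [S [s [t [ε [Ws [_ [Hε]]]]]]] := uniq _ _ _ _ _ _ (lift α eq_refl) (lift β H).
rewrite !whisker_rwhisker -whisker_exchange.
move/(invertible_mono (invertible_hcomp (invertible_id2 _) Hε)).
exact: co_ff_inj (Wcoff Ws).
Qed.

Lemma class_full_invertible (X Y Z : B) (w : Hom Y Z) (f g : Hom X Y)
    (α : w ∘ f ⇒ w ∘ g) :
  W w -> invertible α -> exists β : f ⇒ g, w ◁ β = α /\ invertible β.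
Proof.
move=> Ww [α' [aK Ka]].
have [β Hβ] := class_full α Ww.
have [β' Hβ'] := class_full α' Ww.
exists β; split=> //; exists β'; split; apply: (class_faithful Ww).
  by rewrite lwhisker_vcomp Hβ Hβ' aK hcomp_id.
by rewrite lwhisker_vcomp Hβ Hβ' Ka hcomp_id.
Qed.

Lemma class_iso (X Y Z : B) (w : Hom Y Z) (f g : Hom X Y) :
  W w -> iso (w ∘ f) (w ∘ g) -> iso f g.
Proof.
by move=> Ww [α Hα]; have [β [_ Hβ]] := class_full_invertible Ww Hα; exists β.
Qed.

Lemma class_closed_iso (X Y : B) (v w : Hom X Y) : iso v w -> W w -> W v.
Proof. by move=> [α Hα] Ww; exact: W5 Ww Hα. Qed.

Lemma class_cofaithful (X Y Z : B) (w : Hom Y Z) (q : Hom X Y) :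
  W w -> W (w ∘ q) ->
  forall (T : B) (f g : Hom Y T) (α β : f ⇒ g), α ▷ q = β ▷ q -> α = β.
Proof.
move=> Ww Wwq T f g α β H.
(* WB3 for [w ∘ q] against [w] gives [w ∘ q ∘ h] isomorphic to [w ∘ v] with [v] in [W]; cancelling
   [w] puts [q ∘ h] in [W] by WB5. *)
have [S [h [v [θ [Wv Hθ]]]]] := W3 w Wwq.
have Wqh : W (q ∘ h).
  apply: class_closed_iso Wv; apply: (class_iso Ww).
  by apply: (iso_trans (iso_sym (iso_assoc _ _ _))); exists θ.
apply: (co_ff_inj (Wcoff Wqh)).
by rewrite -!whisker_rwhisker H.
Qed.

(** * Uniqueness of the right-hand 2-cell *)

Lemma comparison_right_unique (X Y C1 C2 D0 D E : B)
    (u1 : Hom C1 X) (u2 : Hom C2 X) (f1 : Hom C1 Y) (f2 : Hom C2 Y)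
    (s1 : Hom D0 C1) (s2 : Hom D0 C2) (t1 : Hom D C1) (t2 : Hom D C2)
    (α : u1 ∘ s1 ⇒ u2 ∘ s2) (β : f1 ∘ s1 ⇒ f2 ∘ s2)
    (γ : u1 ∘ t1 ⇒ u2 ∘ t2) (δ δ' : f1 ∘ t1 ⇒ f2 ∘ t2)
    (p p' : Hom E D0) (q q' : Hom E D)
    (ε1 : s1 ∘ p ⇒ t1 ∘ q) (ε2 : s2 ∘ p ⇒ t2 ∘ q)
    (ε1' : s1 ∘ p' ⇒ t1 ∘ q') (ε2' : s2 ∘ p' ⇒ t2 ∘ q') :
  W u1 -> W u2 -> W (u1 ∘ t1) -> invertible α ->
  invertible ε1 -> invertible ε1' -> iso p p' ->
  (u2 ◁ ε2) • whisker α p = whisker γ q • (u1 ◁ ε1) ->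
  (f2 ◁ ε2) • whisker β p = whisker δ q • (f1 ◁ ε1) ->
  (u2 ◁ ε2') • whisker α p' = whisker γ q' • (u1 ◁ ε1') ->
  (f2 ◁ ε2') • whisker β p' = whisker δ' q' • (f1 ◁ ε1') ->
  whisker δ q = whisker δ' q.
Proof.
move=> Wu1 Wu2 Wut Hα Hε1 Hε1' [η Hη] Hu Hf Hu' Hf'.
have [r [rK Kr]] := Hε1.
(* The isomorphism from [t1 ∘ q] to [t1 ∘ q'] through [η] is first whiskered by [u1], since it is
   [u1 ∘ t1], not [t1], that is known to be fully faithful; faithfulness of [u1] then removes [u1]
   again. *)
have [θ [Hθ θ_inv]] : exists θ : q ⇒ q',
    (t1 ◁ θ) • ε1 = ε1' • (s1 ◁ η) /\ invertible θ.
  have Hκ : invertible (u1 ◁ (ε1' • (s1 ◁ η) • r)).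
    apply: invertible_hcomp; first exact: invertible_id2.
    apply: invertible_vcomp Hε1' _; apply: invertible_vcomp; last by exists ε1.
    exact: invertible_hcomp (invertible_id2 _) Hη.
  have [θ [Hθ θ_inv]] := class_full_invertible Wut (invertible_vcomp
    (invertible_assoc_inv u1 t1 q') (invertible_vcomp Hκ (invertible_assoc u1 t1 q))).
  exists θ; split=> //.
  have -> : t1 ◁ θ = ε1' • (s1 ◁ η) • r.
    apply: (class_faithful Wu1); apply: (invertible_epi (invertible_assoc u1 t1 q)).
    by rewrite -assoc_nat hcomp_id Hθ -vcomp_assoc assoc_inv_K vcomp_id_l.
  by rewrite !vcomp_assoc rK vcomp_id_r.
(* The left-hand equations determine the second comparison cells: after [u2 ◁] and precomposition
   with the invertible [whisker α p], both sides agree. *)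
have H2 : (t2 ◁ θ) • ε2 = ε2' • (s2 ◁ η).
  apply: (class_faithful Wu2); apply: (invertible_epi (invertible_whisker p Hα)).
  rewrite -(comparison_transport Hθ Hu') -Hu.
  by rewrite lwhisker_vcomp vcomp_assoc.
have := comparison_transport Hθ Hf'; rewrite -H2 lwhisker_vcomp.
rewrite vcomp_assoc Hf.
move/(invertible_mono (invertible_hcomp (invertible_id2 _)
  (invertible_hcomp (invertible_id2 _) θ_inv))).
move/(invertible_epi (invertible_hcomp (invertible_id2 _) Hε1)).
by move->.
Qed.

Lemma diagram_equiv_right_unique (X Y : B) (σ1 σ2 : span W X Y)
    (d0 : diagram σ1 σ2) (D : B) (t1 : Hom D (apex σ1)) (t2 : Hom D (apex σ2))
    (γ : lleg σ1 ∘ t1 ⇒ lleg σ2 ∘ t2)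
    (γ_inv : invertible γ) (t1_W : W (lleg σ1 ∘ t1))
    (δ δ' : rleg σ1 ∘ t1 ⇒ rleg σ2 ∘ t2) :
  diagram_equiv d0 (Diagram δ γ_inv t1_W) ->
  diagram_equiv d0 (Diagram δ' γ_inv t1_W) -> δ = δ'.
Proof.
case: d0 => D0 s1 s2 α β Hα Ws1.
move=> [E [p [q [ε1 [ε2]]]]] /= [Hε1 [Hε2 [Wp [Hu Hf]]]].
move=> [E' [p' [q' [ε1' [ε2']]]]] /= [Hε1' [Hε2' [Wp' [Hu' Hf']]]].
(* The two comparisons are brought to a common apex: WB3 makes the legs through [p] and [p']
   isomorphic, and WB2 refines by [c] so that the resulting composite is in [W]. *)
have [T0 [a0 [b0 [ζ [Wb0 Hζ]]]]] := W3 (lleg σ1 ∘ (s1 ∘ p')) Wp.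
have [T [c Wc]] := W2 Wb0 Wp'.
pose a := a0 ∘ c; pose b := b0 ∘ c.
have Hab : iso (lleg σ1 ∘ (s1 ∘ p) ∘ a) (lleg σ1 ∘ (s1 ∘ p') ∘ b).
  by exists (whisker ζ c); exact: invertible_whisker.
have Hη : iso (p ∘ a) (p' ∘ b).
  have H (r : Hom _ D0) (e : Hom T _) :
      iso (lleg σ1 ∘ (s1 ∘ r) ∘ e) (lleg σ1 ∘ s1 ∘ (r ∘ e)).
    apply: iso_trans (iso_assoc _ _ _).
    by apply: iso_comp1r; apply: iso_sym; exact: iso_assoc.
  apply: (class_iso Ws1); apply: (iso_trans (iso_sym (H _ _ _))).
  exact: iso_trans Hab (H _ _ _).
have Wqa : W (lleg σ1 ∘ t1 ∘ (q ∘ a)).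
  apply: class_closed_iso Wc; apply: iso_trans Hab.
  apply: (iso_trans (iso_assoc _ _ _)).
  apply: iso_trans (iso_sym (iso_assoc _ _ _)).
  apply: iso_comp1l; apply: (iso_trans (iso_sym (iso_assoc _ _ _))).
  by apply: iso_comp1r; apply: iso_sym; exists ε1.
apply: (class_cofaithful t1_W Wqa); apply: whisker_inj.
apply: (comparison_right_unique (lleg_W σ1) (lleg_W σ2) t1_W Hα _ _ Hη
  (comparison_whisker a Hu) (comparison_whisker a Hf)
  (comparison_whisker b Hu') (comparison_whisker b Hf')); exact: invertible_whisker.
Qed.

(** * Existence of the right-hand 2-cell *)

Lemma diagram_equiv_right_exists (X Y : B) (σ1 σ2 : span W X Y)
    (d0 : diagram σ1 σ2) (D : B) (t1 : Hom D (apex σ1)) (t2 : Hom D (apex σ2))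
    (γ : lleg σ1 ∘ t1 ⇒ lleg σ2 ∘ t2)
    (γ_inv : invertible γ) (t1_W : W (lleg σ1 ∘ t1)) :
  exists δ : rleg σ1 ∘ t1 ⇒ rleg σ2 ∘ t2,
    diagram_equiv d0 (Diagram δ γ_inv t1_W).
Proof.
case: d0 => D0 s1 s2 α β Hα Ws1.
have [T [h [v [ζ [Wv Hζ]]]]] := W3 (lleg σ1 ∘ t1) Ws1.
have [ε1 Hε1] : iso (s1 ∘ h) (t1 ∘ v).
  apply: (class_iso (lleg_W σ1)); apply: iso_trans (iso_assoc _ _ _).
  by apply: (iso_trans (iso_sym (iso_assoc _ _ _))); exists ζ.
have [αh' [αK Kα]] := invertible_whisker h Hα.
(* The left-hand equation, solved for [lleg σ2 ◁ ε2], prescribes the 2-cell to be lifted. *)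
have Hκ : invertible (whisker γ v • (lleg σ1 ◁ ε1) • αh').
  apply: invertible_vcomp (invertible_whisker _ γ_inv) _.
  apply: (invertible_vcomp (invertible_hcomp (invertible_id2 _) Hε1)).
  by exists (whisker α h).
have [ε2 [Hu Hε2]] := class_full_invertible (lleg_W σ2) Hκ.
have [e [eK Ke]] := invertible_hcomp (invertible_id2 (rleg σ1)) Hε1.
(* The right-hand equation, solved for [whisker δ v], descends along the co-ff arrow [v]. *)
have [δ Hδ] :=
  co_ff_whisker ((rleg σ2 ◁ ε2) • whisker β h • e) (Wcoff Wv).
(* [W] is not assumed closed under composition, so the comparison along [h] and [v] is precomposed
   with a [c] from WB2 to bring its left leg into [W]. *)
have [S [c Wc]] := W2 Wv t1_W.
exists δ, S, (h ∘ c), (v ∘ c), (whisker ε1 c), (whisker ε2 c) => /=.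
split; first exact: invertible_whisker.
split; first exact: invertible_whisker.
split.
  apply: class_closed_iso Wc; apply: iso_trans (iso_sym (iso_assoc _ _ _)).
  by apply: iso_comp1l; exists (whisker ε1 c); exact: invertible_whisker.
split; apply: comparison_whisker.
  rewrite Hu (vcomp_assoc (whisker γ v)) (vcomp_assoc (lleg σ1 ◁ ε1)) αK.
  by rewrite vcomp_id_r.
rewrite Hδ (vcomp_assoc (rleg σ2 ◁ ε2)) (vcomp_assoc (whisker β h)) eK.
by rewrite vcomp_id_r.
Qed.

End CoFullyFaithfulClass.

Theorem corollary5p7 (B : bicategory) (W : arrow_class B)
  (Wcoff : forall (X Y : B) (w : Hom X Y), W X Y w -> co_ff w)
  (W1 : WB1 W) (W2 : WB2 W) (W3 : WB3 W) (W4 : WB4 W) (W5 : WB5 W)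
  (X Y : B) (σ1 σ2 : span W X Y)
  (D : B) (t1 : Hom D (apex σ1)) (t2 : Hom D (apex σ2))
  (γ : lleg σ1 ∘ t1 ⇒ lleg σ2 ∘ t2)
  (γ_inv : invertible γ) (t1_W : W D X (lleg σ1 ∘ t1))
  (Φ : frac_cell σ1 σ2) :
  exists! δ : rleg σ1 ∘ t1 ⇒ rleg σ2 ∘ t2,
    representative Φ (Diagram δ γ_inv t1_W).
Proof.
have [d0 Hd0] := representative_class Φ.
have [δ Hδ] :=
  diagram_equiv_right_exists Wcoff W1 W2 W3 W4 W5 d0 γ_inv t1_W.
exists δ; split; first exact/Hd0.
move=> δ' /Hd0 Hδ'.
exact (diagram_equiv_right_unique Wcoff W1 W2 W3 W4 W5 Hδ Hδ').
Qed.
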